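(* Let $F$ be an algebraically closed field of characteristic $0$. (i) Let $J=K_3$ be the Kaplansky superalgebra. A subalgebra $M$ of $J$ is maximal if and only if $M=J_{\bar 0}\oplus M_{\bar 1}$ where $M_{\bar 1}$ is a vector subspace of $J_{\bar 1}$ with $\dim M_{\bar 1}=1$. (ii) Let $J=D_t$ with $t\in F$, $t\neq 0$. A subalgebra $M$ of $J$ is maximal if and only if either $M=J_{\bar 0}\oplus M_{\bar 1}$ where $M_{\bar 1}$ is a vector subspace of $J_{\bar 1}$ with $\dim M_{\bar 1}=1$, or $t=1$ and $M=F\cdot 1+J_{\bar 1}$. (iii) Let $J=(F\cdot 1+V_{\bar 0})\oplus V_{\bar 1}$ be the Jordan superalgebra of a nondegenerate supersymmetric bilinear superform on a finite dimensional superspace $V=V_{\bar 0}\oplus V_{\bar 1}$ with $V_{\bar 1}\neq 0$. A subalgebra $M$ of $J$ is maximal if and only if either $M=J_{\bar 0}\oplus M_{\bar 1}$ where $M_{\bar 1}$ is a vector subspace of $J_{\bar 1}$ with $\dim M_{\bar 1}=\dim J_{\bar 1}-1$, or $M=(F\cdot 1+M_{\bar 0})\oplus J_{\bar 1}$ where $M_{\bar 0}$ is a vector subspace of $V_{\bar 0}$ with $\dim M_{\bar 0}=\dim V_{\bar 0}-1$.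
   Context: A superalgebra is a $\mathbb Z_2$-graded algebra $J=J_{\bar 0}\oplus J_{\bar 1}$. All subalgebras are graded; a maximal subalgebra is a proper subalgebra which is maximal among proper (graded) subalgebras. All the superalgebras below are supercommutative: $a\cdot b=(-1)^{\bar a\bar b}b\cdot a$ for homogeneous $a,b$ of degrees $\bar a,\bar b$ (so odd elements anticommute and have square $0$). Kaplansky superalgebra $K_3$: $J_{\bar 0}=Fe$, $J_{\bar 1}=Fx+Fy$, with $e^2=e$, $e\cdot x=\frac12x$, $e\cdot y=\frac12 y$, $x\cdot y=e$. $D_t$ ($t\in F\setminus\{0\}$): $J_{\bar 0}=Fe+Ff$, $J_{\bar 1}=Fu+Fv$, with $e^2=e$, $f^2=f$, $e\cdot f=0$, $e\cdot u=\frac12u$, $e\cdot v=\frac12v$, $f\cdot u=\frac12u$, $f\cdot v=\frac12 v$, $u\cdot v=e+tf$. Its identity is $1=e+f$. Superalgebra of a superform: $V=V_{\bar 0}\oplus V_{\bar 1}$ is a superspace with a nondegenerate bilinear form $(\ ,\ )$ which is symmetric on $V_{\bar 0}$, skewsymmetric on $V_{\bar 1}$, and for which $V_{\bar 0}$ and $V_{\bar 1}$ are orthogonal; $J_{\bar 0}=F\cdot 1+V_{\bar 0}$, $J_{\bar 1}=V_{\bar 1}$, with $1$ the identity and $v\cdot w=(v,w)1$ for $v,w\in V$. *)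

(* Defs.v *)
From HB Require Import structures.
From mathcomp Require Import all_boot all_order all_algebra.
From mathcomp Require Import ring.

Set Implicit Arguments.
Unset Strict Implicit.
Unset Printing Implicit Defensive.

Import GRing.Theory.
Local Open Scope ring_scope.

(* The index [b : bool] of [homog V b] is the degree in Z/2, with
   [false] = 0 and [true] = 1; addition of degrees is [addb]. *)
Record superspace (F : fieldType) := Superspace {
  superspace_sort :> vectType F;
  homog : bool -> {vspace superspace_sort};
  homog_direct : (homog false :&: homog true = 0)%VS;
  homog_full : (homog false + homog true = fullv)%VS
}.

Notation even_part V := (homog V false).
Notation odd_part V := (homog V true).

Record superalgebra (F : fieldType) := Superalgebra {
  superalgebra_space :> superspace F;
  smul : {bilinear superalgebra_space -> superalgebra_space
            -> superalgebra_space};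
  smul_homog : forall a b x y,
    x \in homog superalgebra_space a -> y \in homog superalgebra_space b ->
    smul x y \in homog superalgebra_space (a (+) b)
}.

Definition supercommutative (F : fieldType) (J : superalgebra F) : Prop :=
  forall a b x y, x \in homog J a -> y \in homog J b ->
    smul J x y = (-1) ^+ (a && b) *: smul J y x.

Section Subalgebras.
Variables (F : fieldType) (J : superalgebra F).
Implicit Types M N : {vspace J}.

Definition graded M : Prop :=
  M = (M :&: even_part J + M :&: odd_part J)%VS.

Definition mul_closed M : Prop := {in M &, forall x y, smul J x y \in M}.

(* Subalgebras are not required to contain an identity of [J]. *)
Definition subalgebra M : Prop := graded M /\ mul_closed M.

Definition maximal_subalgebra M : Prop :=
  [/\ subalgebra M, M != fullv
    & forall N, subalgebra N -> N != fullv -> (M <= N)%VS -> N = M].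

End Subalgebras.

Section Kaplansky.
Variable F : fieldType.

(* [(a, b, c)] stands for [a e + b x + c y]. *)
Local Notation T := (F^o * F^o * F^o)%type.

Definition K3e : T := (1, 0, 0).
Definition K3x : T := (0, 1, 0).
Definition K3y : T := (0, 0, 1).

Definition K3_homog (d : bool) : {vspace T} :=
  if d then (<[K3x]> + <[K3y]>)%VS else <[K3e]>%VS.

Definition K3_mul (p q : T) : T :=
  let: (a, b, c) := p in let: (a', b', c') := q in
  (a * a' + (b * c' - c * b'),
   2^-1 * (a * b' + b * a'),
   2^-1 * (a * c' + c * a')).

Lemma K3_evenP (p : T) :
  reflect (p.1.2 = 0 /\ p.2 = 0) (p \in K3_homog false).
Proof.
apply: (iffP (vlineP _ _)) => [[k ->]|]; first by rewrite /= !scaler0.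
case: p => [[a b] c] /= [-> ->]; exists a.
by congr (_, _, _); rewrite /= ?scaler0 //; apply: esym; apply: mulr1.
Qed.

Lemma K3_oddP (p : T) : reflect (p.1.1 = 0) (p \in K3_homog true).
Proof.
apply: (iffP idP) => [/memv_addP[_ /vlineP[k ->]] [_ /vlineP[l ->]] ->|].
  by rewrite /= !scaler0 addr0.
case: p => [[a b] c] /= ->.
have -> : (0, b, c) = b *: K3x + c *: K3y :> T.
  by congr (_, _, _); rewrite /= ?scaler0 ?addr0 ?add0r //;
    apply: esym; apply: mulr1.
by apply: memv_add; apply: memvZ; apply: memv_line.
Qed.

Lemma K3_direct : (K3_homog false :&: K3_homog true = 0)%VS.
Proof.
apply/eqP; rewrite -subv0; apply/subvP => -[[a b] c].
by rewrite memv_cap => /andP[/K3_evenP/= [-> ->] /K3_oddP/= ->]; rewrite mem0v.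
Qed.

Lemma K3_full : (K3_homog false + K3_homog true = fullv)%VS.
Proof.
apply/eqP; rewrite eqEsubv subvf; apply/subvP => -[[a b] c] _.
have -> : (a, b, c) = (a, 0, 0) + (0, b, c) :> T.
  by congr (_, _, _); rewrite /= ?addr0 ?add0r.
by apply: memv_add; [apply/K3_evenP | apply/K3_oddP].
Qed.

Definition K3_space : superspace F := Superspace K3_direct K3_full.

Fact K3_bilinear : bilinear_for *:%R *:%R K3_mul.
Proof.
by split=> -[[a b] c] k [[? ?] ?] [[? ?] ?];
  congr (_, _, _); rewrite /= /GRing.scale /=; ring.
Qed.

HB.instance Definition _ := bilinear_isBilinear.Build F T T T *:%R *:%R
  K3_mul K3_bilinear.

Fact K3_mul_homog a b (x y : T) :
  x \in K3_homog a -> y \in K3_homog b -> K3_mul x y \in K3_homog (a (+) b).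
Proof.
by case: x y => [[? ?] ?] [[? ?] ?]; case: a; case: b => /=;
  do 2?[move/K3_evenP => /= [-> ->] | move/K3_oddP => /= ->];
  (apply/K3_evenP || apply/K3_oddP); rewrite /= ?(mulr0, mul0r, addr0, subr0).
Qed.

Definition K3 : superalgebra F := @Superalgebra F K3_space K3_mul K3_mul_homog.

End Kaplansky.

Section Dt.
Variables (F : fieldType) (t : F).

(* [(a, b, c, d)] stands for [a e + b f + c u + d v]. *)
Local Notation T := (F^o * F^o * F^o * F^o)%type.

Definition De : T := (1, 0, 0, 0).
Definition Df : T := (0, 1, 0, 0).
Definition Du : T := (0, 0, 1, 0).
Definition Dv : T := (0, 0, 0, 1).

Definition D_homog (d : bool) : {vspace T} :=
  if d then (<[Du]> + <[Dv]>)%VS else (<[De]> + <[Df]>)%VS.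

Definition D_mul (p q : T) : T :=
  let: (a, b, c, d) := p in let: (a', b', c', d') := q in
  (a * a' + (c * d' - d * c'),
   b * b' + t * (c * d' - d * c'),
   2^-1 * ((a + b) * c' + c * (a' + b')),
   2^-1 * ((a + b) * d' + d * (a' + b'))).

Lemma D_evenP (p : T) : reflect (p.1.2 = 0 /\ p.2 = 0) (p \in D_homog false).
Proof.
apply: (iffP idP) => [/memv_addP[_ /vlineP[k ->]] [_ /vlineP[l ->]] ->|].
  by rewrite /= !scaler0 addr0.
case: p => [[[a b] c] d] /= [-> ->].
have -> : (a, b, 0, 0) = a *: De + b *: Df :> T.
  by congr (_, _, _, _); rewrite /= ?scaler0 ?addr0 ?add0r //;
    apply: esym; apply: mulr1.
by apply: memv_add; apply: memvZ; apply: memv_line.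
Qed.

Lemma D_oddP (p : T) :
  reflect (p.1.1.1 = 0 /\ p.1.1.2 = 0) (p \in D_homog true).
Proof.
apply: (iffP idP) => [/memv_addP[_ /vlineP[k ->]] [_ /vlineP[l ->]] ->|].
  by rewrite /= !scaler0 addr0.
case: p => [[[a b] c] d] /= [-> ->].
have -> : (0, 0, c, d) = c *: Du + d *: Dv :> T.
  by congr (_, _, _, _); rewrite /= ?scaler0 ?addr0 ?add0r //;
    apply: esym; apply: mulr1.
by apply: memv_add; apply: memvZ; apply: memv_line.
Qed.

Lemma D_direct : (D_homog false :&: D_homog true = 0)%VS.
Proof.
apply/eqP; rewrite -subv0; apply/subvP => -[[[a b] c] d].
by rewrite memv_cap => /andP[/D_evenP/= [-> ->] /D_oddP/= [-> ->]];
  rewrite mem0v.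
Qed.

Lemma D_full : (D_homog false + D_homog true = fullv)%VS.
Proof.
apply/eqP; rewrite eqEsubv subvf; apply/subvP => -[[[a b] c] d] _.
have -> : (a, b, c, d) = (a, b, 0, 0) + (0, 0, c, d) :> T.
  by congr (_, _, _, _); rewrite /= ?addr0 ?add0r.
by apply: memv_add; [apply/D_evenP | apply/D_oddP].
Qed.

Definition D_space : superspace F := Superspace D_direct D_full.

Fact D_bilinear : bilinear_for *:%R *:%R D_mul.
Proof.
by split=> -[[[a b] c] d] k [[[? ?] ?] ?] [[[? ?] ?] ?];
  congr (_, _, _, _); rewrite /= /GRing.scale /=; ring.
Qed.

HB.instance Definition _ := bilinear_isBilinear.Build F T T T *:%R *:%R
  D_mul D_bilinear.

Fact D_mul_homog a b (x y : T) :
  x \in D_homog a -> y \in D_homog b -> D_mul x y \in D_homog (a (+) b).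
Proof.
by case: x y => [[[? ?] ?] ?] [[[? ?] ?] ?]; case: a; case: b => /=;
  do 2?[move/D_evenP => /= [-> ->] | move/D_oddP => /= [-> ->]];
  (apply/D_evenP || apply/D_oddP);
  rewrite /= ?(mulr0, mul0r, addr0, subr0).
Qed.

Definition D : superalgebra F := @Superalgebra F D_space D_mul D_mul_homog.

Definition D_one : D := De + Df.

End Dt.

Record superform (F : fieldType) (V : superspace F) := Superform {
  superform_val :> {biscalar V};
  superform_sym : {in even_part V &, forall v w,
    superform_val v w = superform_val w v};
  superform_skew : {in odd_part V &, forall v w,
    superform_val v w = - superform_val w v};
  superform_orthol : {in even_part V & odd_part V, forall v w,
    superform_val v w = 0};
  superform_orthor : {in odd_part V & even_part V, forall v w,
    superform_val v w = 0};
}.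

(* A trivial left radical suffices: by supersymmetry the two radicals agree. *)
Definition nondegenerate_superform (F : fieldType) (V : superspace F)
    (B : superform V) : Prop :=
  forall v : V, (forall w : V, B v w = 0) -> v = 0.

Section SuperformAlgebra.
Variables (F : fieldType) (V : superspace F) (B : superform V).

(* [(a, v)] stands for [a 1 + v]. *)
Local Notation T := (F^o * V)%type.

Definition SF_inj_fun (v : V) : T := (0, v).

Fact SF_inj_linear : linear SF_inj_fun.
Proof. by move=> k v w; congr (_, _); rewrite /= scaler0 addr0. Qed.

HB.instance Definition _ := GRing.isLinear.Build F V T *:%R
  SF_inj_fun SF_inj_linear.

Definition SF_inj : 'Hom(V, T) := linfun SF_inj_fun.

Lemma SF_injE v : SF_inj v = (0, v).
Proof. exact: lfunE. Qed.

Definition SF_unit : T := (1, 0).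

Definition SF_homog (d : bool) : {vspace T} :=
  if d then (SF_inj @: odd_part V)%VS
  else (<[SF_unit]> + SF_inj @: even_part V)%VS.

Definition SF_mul (p q : T) : T :=
  ((p.1 : F) * q.1 + B p.2 q.2, (p.1 : F) *: q.2 + (q.1 : F) *: p.2).

Lemma SF_evenP (p : T) : reflect (p.2 \in even_part V) (p \in SF_homog false).
Proof.
apply: (iffP idP) => [/memv_addP[_ /vlineP[k ->]] [_ /memv_imgP[v Vv ->]] ->|].
  by rewrite SF_injE /= scaler0 add0r.
case: p => a v /= Vv.
have -> : (a, v) = a *: SF_unit + SF_inj v.
  rewrite SF_injE; congr (_, _); rewrite /= ?scaler0 ?add0r ?addr0 //.
  by apply: esym; apply: mulr1.
by apply: memv_add; [apply: memvZ; apply: memv_line | apply: memv_img].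
Qed.

Lemma SF_oddP (p : T) :
  reflect (p.1 = 0 /\ p.2 \in odd_part V) (p \in SF_homog true).
Proof.
apply: (iffP memv_imgP) => [[v Vv ->]|]; first by rewrite SF_injE.
by case: p => a v /= [-> Vv]; exists v; rewrite ?SF_injE.
Qed.

Lemma SF_direct : (SF_homog false :&: SF_homog true = 0)%VS.
Proof.
apply/eqP; rewrite -subv0; apply/subvP => -[a v].
rewrite memv_cap => /andP[/SF_evenP/= V0v /SF_oddP/= [-> V1v]].
have : v \in (even_part V :&: odd_part V)%VS by rewrite memv_cap V0v.
by rewrite homog_direct memv0 => /eqP->; rewrite mem0v.
Qed.

Lemma SF_full : (SF_homog false + SF_homog true = fullv)%VS.
Proof.
apply/eqP; rewrite eqEsubv subvf; apply/subvP => -[a v] _.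
have := memvf v; rewrite -homog_full => /memv_addP[v0 V0v [v1 V1v ->]].
have -> : (a, v0 + v1) = (a, v0) + (0, v1) :> T.
  by congr (_, _); rewrite /= addr0.
by apply: memv_add; [apply/SF_evenP | apply/SF_oddP].
Qed.

Definition SF_space : superspace F := Superspace SF_direct SF_full.

Fact SF_bilinear : bilinear_for *:%R *:%R SF_mul.
Proof.
split=> -[a v] k [b w] [c z]; congr (_, _) => /=.
- by rewrite linearPl /GRing.scale /=; ring.
- by rewrite !(scalerDl, scalerDr, scalerA) addrACA (mulrC (a : F) k).
- by rewrite linearPr /GRing.scale /=; ring.
- by rewrite !(scalerDl, scalerDr, scalerA) addrACA (mulrC (a : F) k).
Qed.

HB.instance Definition _ := bilinear_isBilinear.Build F T T T *:%R *:%R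
  SF_mul SF_bilinear.

Fact SF_mul_homog a b (x y : T) :
  x \in SF_homog a -> y \in SF_homog b -> SF_mul x y \in SF_homog (a (+) b).
Proof.
case: x y => [k v] [l w]; case: a; case: b => /=.
- by move=> /SF_oddP/= [-> _] /SF_oddP/= [-> _]; apply/SF_evenP;
    rewrite /= !scale0r addr0 mem0v.
- move=> /SF_oddP/= [-> Vv] /SF_evenP/= Vw; apply/SF_oddP.
  by rewrite /= (superform_orthor B) // mul0r scale0r !add0r memvZ.
- move=> /SF_evenP/= Vv /SF_oddP/= [-> Vw]; apply/SF_oddP.
  by rewrite /= (superform_orthol B) // mulr0 scale0r !addr0 memvZ.
- by move=> /SF_evenP/= Vv /SF_evenP/= Vw; apply/SF_evenP;
    rewrite /= memvD ?memvZ.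
Qed.

Definition SF : superalgebra F := @Superalgebra F SF_space SF_mul SF_mul_homog.

Definition SF_one : SF := SF_unit.

End SuperformAlgebra.

Section Tables.
Variable F : fieldType.

Lemma K3_supercommutative : supercommutative (K3 F).
Proof.
move=> a b [[? ?] ?] [[? ?] ?]; case: a; case: b;
  do 2?[move/K3_evenP => /= [-> ->] | move/K3_oddP => /= ->];
  by congr (_, _, _); rewrite /= /GRing.scale /=; ring.
Qed.

Lemma K3_table (J := K3 F) (e := K3e F) (x := K3x F) (y := K3y F) :
  [/\ smul J e e = e, smul J e x = 2^-1 *: x, smul J e y = 2^-1 *: y
    & smul J x y = e].
Proof.
by split; congr (_, _, _); rewrite /= /GRing.scale /=; ring.
Qed.

Lemma D_supercommutative (t : F) : supercommutative (D t).
Proof.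
move=> a b [[[? ?] ?] ?] [[[? ?] ?] ?]; case: a; case: b;
  do 2?[move/D_evenP => /= [-> ->] | move/D_oddP => /= [-> ->]];
  by congr (_, _, _, _); rewrite /= /GRing.scale /=; ring.
Qed.

Lemma D_table (t : F) (J := D t) (e := De F) (f := Df F)
    (u := Du F) (v := Dv F) :
  [/\ smul J e e = e, smul J f f = f & smul J e f = 0] /\
  [/\ smul J e u = 2^-1 *: u, smul J e v = 2^-1 *: v,
      smul J f u = 2^-1 *: u, smul J f v = 2^-1 *: v
    & smul J u v = e + t *: f].
Proof.
by do ![split]; congr (_, _, _, _); rewrite /= /GRing.scale /=; ring.
Qed.

Lemma D_mul1 (t : F) (p : D t) : (2 : F) != 0 -> smul (D t) (D_one t) p = p.
Proof.
move=> two_neq0; case: p => [[[a b] c] d].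
by congr (_, _, _, _); rewrite /= ?(addr0, add0r); field.
Qed.

Variables (V : superspace F) (B : superform V).

Lemma SF_supercommutative : supercommutative (SF B).
Proof.
move=> a b [k v] [l w]; case: a; case: b => /=.
- move=> /SF_oddP/= [-> Vv] /SF_oddP/= [-> Vw]; congr (_, _) => /=.
    by rewrite (superform_skew B) // /GRing.scale /=; ring.
  by rewrite !scale0r addr0 scaler0.
- move=> /SF_oddP/= [-> Vv] /SF_evenP/= Vw; congr (_, _) => /=.
    by rewrite (superform_orthor B) // (superform_orthol B) // /GRing.scale /=;
      ring.
  by rewrite scale1r addrC.
- move=> /SF_evenP/= Vv /SF_oddP/= [-> Vw]; congr (_, _) => /=.
    by rewrite (superform_orthol B) // (superform_orthor B) // /GRing.scale /=;
      ring.
  by rewrite scale1r addrC.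
- move=> /SF_evenP/= Vv /SF_evenP/= Vw; congr (_, _) => /=.
    by rewrite (superform_sym B) // /GRing.scale /=; ring.
  by rewrite scale1r addrC.
Qed.

Lemma SF_mul1 (p : SF B) : smul (SF B) (SF_one B) p = p.
Proof.
case: p => a v; congr (_, _) => /=; last by rewrite scaler0 addr0 scale1r.
by rewrite linear0l addr0 mul1r.
Qed.

Lemma SF_mulV (v w : V) :
  smul (SF B) (SF_inj V v) (SF_inj V w) = B v w *: SF_one B.
Proof.
rewrite !SF_injE; congr (_, _) => /=.
  by rewrite mul0r add0r; apply: esym; apply: mulr1.
by rewrite !scale0r addr0 scaler0.
Qed.

End Tables.

(* Main.v *)
Require Import Defs.
From mathcomp Require Import all_boot all_order all_algebra.
From mathcomp Require Import ring zify.

Set Implicit Arguments.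
Unset Strict Implicit.
Unset Printing Implicit Defensive.

Import GRing.Theory.
Local Open Scope ring_scope.

(** In every part of the theorem the listed subalgebras are hyperplanes of [J],
    and a subalgebra that is a hyperplane is maximal for dimension reasons
    ([hyperplane_maximal]).  The content is the other direction.

    In all three families an even element acts on the odd part as a scalar, so
    the even part plus any odd subspace [O] is a subalgebra: products of two
    elements of [O] are even, whatever [O] is.  Hence a maximal [M] that misses
    part of the odd part lies in the subalgebra spanned by the even part and a
    hyperplane of the odd part, and is equal to it ([maximal_missing_odd]).

    There remain the proper subalgebras [M] that contain the whole odd part.
    - In [K_3] there are none, because [x y = e].
    - In [D_t] such an [M] contains [e + t f] and has dimension at most 3, so it
      is spanned by [e + t f] and the odd part; closure under squaring, that is
      [e + t^2 f] in [M], then forces [t^2 = t] ([D_proper_with_odd]).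
    - In the superalgebra of a superform, nondegeneracy on the nonzero odd part
      puts [1] in [M].  Every subspace containing [1] is closed under the
      product, because [x y] is always a combination of [x], [y] and [1].  So
      the part of [V_0] in [M] can be enlarged to a hyperplane of [V_0] without
      leaving the class of proper subalgebras ([SF_maximal_with_odd]). *)

(** * Hyperplanes *)

(** Adding to [U] a complement in [W] of [U + <w>], for some [w] in [W] outside
    [U], leaves only the line of [w] missing. *)
Lemma hyperplane_above (F : fieldType) (vT : vectType F) (U W : {vspace vT}) :
  (U <= W)%VS -> ~~ (W <= U)%VS ->
  exists H : {vspace vT},
    [/\ (U <= H)%VS, (H <= W)%VS & (\dim H).+1 = \dim W].
Proof.
move=> sUW /subvPn[w Ww notUw].
pose C := (W :\: (U + <[w]>))%VS; exists (U + C)%VS.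
have notHw : w \notin (U + C)%VS.
  apply: contra notUw => /memv_addP[u Uu [c Cc def_w]].
  have : c \in (C :&: (U + <[w]>))%VS.
    rewrite memv_cap Cc -(addKr u c) -def_w.
    by rewrite memv_add ?memv_line // memvN.
  by rewrite capv_diff memv0 def_w => /eqP->; rewrite addr0.
split; first exact: addvSl.
  by rewrite subv_add sUW diffvSl.
have -> : W = (U + C + <[w]>)%VS.
  rewrite -addvA (addvC C) addvA addvC addv_diff; apply: esym; apply/addv_idPl.
  by rewrite subv_add sUW -memvE.
have w0 : w != 0 by apply: contraNneq notUw => ->; rewrite mem0v.
suff disj : ((U + C) :&: <[w]> = 0)%VS.
  by rewrite (dimv_disjoint_sum disj) dim_vline w0 addn1.
apply/eqP; rewrite -subv0; apply/subvP => z; rewrite memv_cap memv0.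
case/andP=> Hz /vlineP[k def_z]; rewrite def_z in Hz *.
apply: contraR notHw => kw0.
have k0 : k != 0 by apply: contraNneq kw0 => ->; rewrite scale0r.
by rewrite -[w](scalerK k0) memvZ.
Qed.

(** * Maximal subalgebras of general superalgebras *)

Section GeneralSuperalgebra.

Variables (F : fieldType) (J : superalgebra F).
Implicit Types M N E O : {vspace J}.

Lemma graded_sum E O :
  (E <= even_part J)%VS -> (O <= odd_part J)%VS -> graded (E + O)%VS.
Proof.
move=> sE sO; apply/eqP; rewrite /graded eqEsubv; apply/andP; split.
  by apply: addvS; rewrite subv_cap ?sE ?sO ?addvSl ?addvSr.
by rewrite subv_add !capvSl.
Qed.

Lemma dim_graded_sum E O :
  (E <= even_part J)%VS -> (O <= odd_part J)%VS ->
  \dim (E + O) = (\dim E + \dim O)%N.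
Proof.
move=> sE sO; apply: dimv_disjoint_sum; apply/eqP.
by rewrite -subv0 -(homog_direct J) capvS.
Qed.

Lemma dim_parts : \dim {:J} = (\dim (even_part J) + \dim (odd_part J))%N.
Proof. by rewrite -(homog_full J) dim_graded_sum. Qed.

Lemma hyperplane_proper M : (\dim M).+1 = \dim {:J} -> M != fullv.
Proof. by move=> dM; apply: contraPneq dM => -> /esym/n_Sn. Qed.

Lemma hyperplane_maximal M :
  subalgebra M -> (\dim M).+1 = \dim {:J} -> maximal_subalgebra M.
Proof.
move=> subM dM; split=> // [|N _ properN sMN]; first exact: hyperplane_proper.
apply/esym/eqP; rewrite eqEdim sMN /= -ltnS dM ltnNge.
by apply: contra properN => dN; rewrite eqEdim subvf.
Qed.

(** Each even element acts on the odd part as a scalar: asking only that every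
    odd vector be an eigenvector is equivalent, and easier to check. *)
Definition even_scalar_action :=
  {in even_part J & odd_part J, forall x y, smul J x y \in <[y]>%VS}.

(** Products of two odd elements fall in the even part, and scalar actions
    preserve every subspace. *)
Lemma even_sum_subalgebra O :
  supercommutative J -> even_scalar_action -> (O <= odd_part J)%VS ->
  subalgebra (even_part J + O)%VS.
Proof.
move=> scJ actJ sO; split; first exact: graded_sum.
move=> _ _ /memv_addP[x0 ex0 [x1 Ox1 ->]] /memv_addP[y0 ey0 [y1 Oy1 ->]].
have oo z : z \in O -> z \in odd_part J by apply: (subvP sO).
have actO x y : x \in even_part J -> y \in O -> smul J x y \in O.
  move=> ex Oy; have /vlineP[k ->] := actJ _ _ ex (oo _ Oy); exact: memvZ.
rewrite linearDl !linearDr /= [smul J x1 y0 + _]addrC addrACA; apply: memv_add.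
  apply: memvD; first exact: (smul_homog (a:=false) (b:=false)).
  by apply: (smul_homog (a:=true) (b:=true)); apply: oo.
apply: memvD; first exact: actO.
rewrite (scJ true false) ?oo //; apply/memvZ; exact: actO.
Qed.

(** [M] lies in the even part plus any odd hyperplane [H] that contains the odd
    part of [M]; this sum is a proper subalgebra, so maximality makes [M] equal
    to it. *)
Lemma maximal_missing_odd M :
  supercommutative J -> even_scalar_action ->
  maximal_subalgebra M -> ~~ (odd_part J <= M)%VS ->
  exists M1 : {vspace J}, [/\ (M1 <= odd_part J)%VS,
    (\dim M1).+1 = \dim (odd_part J) & M = (even_part J + M1)%VS].
Proof.
move=> scJ actJ [[gM _] _ maxM] notM.
have [||H [sMH sH dH]] := @hyperplane_above _ _ (M :&: odd_part J)%VS (odd_part J).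
- exact: capvSr.
- by rewrite subv_cap subvv andbT.
exists H; split=> //; apply/esym/maxM.
- exact: even_sum_subalgebra.
- by apply: hyperplane_proper; rewrite dim_graded_sum // -addnS dH dim_parts.
- by rewrite gM addvS ?capvSr.
Qed.

Lemma even_sum_maximal (M1 : {vspace J}) :
  (M1 <= odd_part J)%VS -> (\dim M1).+1 = \dim (odd_part J) ->
  subalgebra (even_part J + M1)%VS -> maximal_subalgebra (even_part J + M1)%VS.
Proof.
move=> sM1 dM1 subM; apply: hyperplane_maximal => //.
by rewrite dim_graded_sum // -addnS dM1 dim_parts.
Qed.

Lemma sum_odd_maximal (M0 : {vspace J}) :
  (M0 <= even_part J)%VS -> (\dim M0).+1 = \dim (even_part J) ->
  subalgebra (M0 + odd_part J)%VS -> maximal_subalgebra (M0 + odd_part J)%VS.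
Proof.
move=> sM0 dM0 subM; apply: hyperplane_maximal => //.
by rewrite dim_graded_sum // -addSn dM0 dim_parts.
Qed.

End GeneralSuperalgebra.

(** * The Kaplansky superalgebra *)

Section K3.
Variable F : fieldType.

Lemma dim_K3_odd : \dim (odd_part (K3 F)) = 2.
Proof.
have := dim_parts (K3 F); rewrite dimvf /= dim_vline.
rewrite (_ : K3e F != 0) => [[/esym]|] //.
by apply/eqP => -[/eqP]; rewrite oner_eq0.
Qed.

Lemma K3_scalar_action : even_scalar_action (K3 F).
Proof.
move=> [[a b] c] [[a' b'] c'] /K3_evenP/= [-> ->] /K3_oddP/= ->.
apply/vlineP; exists (2^-1 * a).
by congr (_, _, _); rewrite /= /GRing.scale /=; ring.
Qed.

Lemma K3_odd_generates (M : {vspace K3 F}) :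
  mul_closed M -> (odd_part (K3 F) <= M)%VS -> M = fullv.
Proof.
move=> mulM oddM; apply/eqP; rewrite eqEsubv subvf -(homog_full (K3 F)).
rewrite subv_add oddM andbT -memvE; have [_ _ _ <-] := K3_table F.
by apply: mulM; apply: (subvP oddM); apply/K3_oddP.
Qed.

Theorem K3_maximal_subalgebra (M : {vspace K3 F}) : subalgebra M ->
  (maximal_subalgebra M <->
   exists M1 : {vspace K3 F}, [/\ (M1 <= odd_part (K3 F))%VS, \dim M1 = 1%N
     & M = (even_part (K3 F) + M1)%VS]).
Proof.
move=> subM; split=> [maxM|[M1 [sM1 dM1 defM]]].
  have [|M1 [sM1 dM1 ->]] := maximal_missing_odd (@K3_supercommutative F)
    (@K3_scalar_action) maxM.
    case: maxM => _ properM _; apply: contra properM => oddM.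
    by apply/eqP/K3_odd_generates => //; case: subM.
  by exists M1; split=> //; move: dM1; rewrite dim_K3_odd => -[].
by rewrite defM in subM *; apply: even_sum_maximal; rewrite ?dM1 ?dim_K3_odd.
Qed.

End K3.

(** * The superalgebras D_t *)

Section Dt.
Variables (F : fieldType) (t : F).

(** Each part is spanned by two vectors and the whole space has dimension 4, so
    neither dimension can drop below 2. *)
Lemma dim_D_parts d : \dim (homog (D t) d) = 2.
Proof.
have le2 (x y : D t) : (\dim (<[x]> + <[y]>)%VS <= 2)%N.
  apply: leq_trans (dimv_add_leqif _ _) _.
  by rewrite !dim_vline; do 2!case: (_ != 0).
have le_even : (\dim (even_part (D t)) <= 2)%N := le2 (De F) (Df F).
have le_odd : (\dim (odd_part (D t)) <= 2)%N := le2 (Du F) (Dv F).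
have := dim_parts (D t); rewrite dimvf => /(@esym nat 4).
by case: d; lia.
Qed.

Lemma D_scalar_action : even_scalar_action (D t).
Proof.
move=> [[[a b] c] d] [[[a' b'] c'] d'] /D_evenP/= [-> ->] /D_oddP/= [-> ->].
apply/vlineP; exists (2^-1 * (a + b)).
by congr (_, _, _, _); rewrite /= /GRing.scale /=; ring.
Qed.

Lemma dim_line_D_odd (p : D t) : p \in even_part (D t) -> p != 0 ->
  \dim (<[p]> + odd_part (D t)) = 3.
Proof.
move=> ep p0; rewrite dim_graded_sum -?memvE //.
by rewrite dim_vline p0 dim_D_parts.
Qed.

(** Properness bounds the dimension by 3, which the span of [u v = e + t f] and
    the odd part already attains.  The square [e + t^2 f] must then be a multiple
    of [e + t f]. *)
Lemma D_proper_with_odd (M : {vspace D t}) : t != 0 -> mul_closed M -> M != fullv ->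
  (odd_part (D t) <= M)%VS -> t = 1 /\ M = (<[D_one t]> + odd_part (D t))%VS.
Proof.
move=> t0 mulM properM oddM; pose p : D t := De F + t *: Df F.
have [_ [_ _ _ _ uv]] := D_table t.
have Mp : p \in M.
  by rewrite /p -uv; apply: mulM; apply: (subvP oddM); apply/D_oddP.
have defp : p = (1, t, 0, 0).
  by congr (_, _, _, _); rewrite /= /GRing.scale /=; ring.
have ep : p \in even_part (D t) by rewrite defp; apply/D_evenP.
have p0 : p != 0 by rewrite defp; apply/eqP => -[/eqP]; rewrite oner_eq0.
have defM : M = (<[p]> + odd_part (D t))%VS.
  apply/esym/eqP; rewrite eqEdim subv_add -memvE Mp oddM /=.
  rewrite dim_line_D_odd // -ltnS ltnNge; apply: contra properM => dM.
  by rewrite eqEdim subvf dimvf.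
have t1 : t = 1.
  have := mulM _ _ Mp Mp; rewrite defM defp.
  case/memv_addP=> _ /vlineP[k ->] [q /D_oddP].
  case: q => [[[a b] c] d] /= [-> ->] [].
  rewrite /GRing.scale /= !(mulr1, mulr0, subr0, addr0) => <-.
  by move/(mulIf t0).
by split=> //; rewrite defM /p t1 scale1r.
Qed.

Theorem D_maximal_subalgebra (M : {vspace D t}) : t != 0 -> subalgebra M ->
  (maximal_subalgebra M <->
   (exists M1 : {vspace D t}, [/\ (M1 <= odd_part (D t))%VS, \dim M1 = 1%N
      & M = (even_part (D t) + M1)%VS])
   \/ (t = 1 /\ M = (<[D_one t]> + odd_part (D t))%VS)).
Proof.
move=> t0 subM; split=> [maxM|[[M1 [sM1 dM1 defM]]|[_ defM]]].
- have [oddM|notM] := boolP (odd_part (D t) <= M)%VS.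
    by right; case: maxM subM => _ properM _ [_ mulM]; apply: D_proper_with_odd.
  left; have [M1 [sM1 dM1 ->]] := maximal_missing_odd (@D_supercommutative F t)
    (@D_scalar_action) maxM notM.
  by exists M1; split=> //; move: dM1; rewrite dim_D_parts => -[].
- by rewrite defM in subM *; apply: even_sum_maximal; rewrite ?dM1 ?dim_D_parts.
- apply: hyperplane_maximal => //; rewrite defM dim_line_D_odd ?dimvf //.
    by apply/D_evenP; rewrite /= !addr0.
  by apply/eqP => -[/eqP]; rewrite addr0 oner_eq0.
Qed.

End Dt.

(** * Superalgebras of superforms *)

Section SF.
Variables (F : fieldType) (V : superspace F) (B : superform V).
Local Notation J := (SF B).

Lemma SF_scalar_action : even_scalar_action J.
Proof.
move=> [a v] [b w] /SF_evenP/= ev /SF_oddP/= [-> ow].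
apply/vlineP; exists a; congr (_, _) => /=.
  by rewrite (superform_orthol B) // addr0.
by rewrite scale0r addr0.
Qed.

(** The product [(a + v)(b + w)] differs from [a (b + w) + b (a + v)] by the
    scalar [B v w - a b]. *)
Lemma SF_unital_mul_closed (M : {vspace J}) : SF_one B \in M -> mul_closed M.
Proof.
move=> M1 [a v] [b w] Mx My.
have -> : smul J (a, v) (b, w) =
    a *: ((b, w) : J) + b *: ((a, v) : J) + (B v w - a * b) *: SF_one B.
  congr (_, _) => /=; first by rewrite /GRing.scale /=; ring.
  by rewrite scaler0 addr0.
by rewrite !memvD ?memvZ.
Qed.

Lemma dim_unit_sum (U : {vspace V}) :
  \dim (<[SF_one B]> + SF_inj V @: U)%VS = (\dim U).+1.
Proof.
rewrite dimv_disjoint_sum.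
  rewrite dim_vline limg_dim_eq.
    by rewrite (_ : SF_one B != 0) //; apply/eqP => -[/eqP]; rewrite oner_eq0.
  apply/eqP; rewrite -subv0; apply/subvP => v.
  by rewrite memv_cap memv_ker SF_injE memv0 => /andP[_ /eqP[->]].
apply/eqP; rewrite -subv0; apply/subvP => z; rewrite memv_cap memv0.
case/andP=> /vlineP[k ->] /memv_imgP[v _]; rewrite SF_injE => -[k0 _].
have -> : k = 0 by rewrite -k0; apply/esym/mulr1.
by rewrite scale0r.
Qed.

Lemma unit_sum_even (U : {vspace V}) : (U <= even_part V)%VS ->
  (<[SF_one B]> + SF_inj V @: U <= even_part J)%VS.
Proof. by move=> sU; apply: addvS => //; apply: limgS. Qed.

(** If [1] is not in [M] then [B v w1 = 0] for all odd [v] and [w1], since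
    [v w1 = B v w1 1] is in [M].  An odd [v] is also orthogonal to the even
    vectors, so nondegeneracy kills the whole odd part. *)
Lemma SF_one_generated (M : {vspace J}) : nondegenerate_superform B ->
  odd_part V != 0%VS -> mul_closed M -> (odd_part J <= M)%VS -> SF_one B \in M.
Proof.
move=> ndB V1 mulM oddM; apply: contraR V1 => notM1.
rewrite -subv0; apply/subvP => v ov; rewrite memv0; apply/eqP/ndB => w.
have := memvf w; rewrite -(homog_full V) => /memv_addP[w0 ew0 [w1 ow1 ->]].
rewrite linearDr /= (superform_orthor B) // add0r.
apply: contraNeq notM1 => Bvw.
rewrite -[SF_one B](scalerK Bvw) -SF_mulV memvZ //.
by apply: mulM; apply: (subvP oddM); apply: memv_img.
Qed.

(** [M] does not contain all of [V_0], or else it would be everything; any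
    hyperplane of [V_0] above the vectors that it contains yields a proper subalgebra above [M]. *)
Lemma SF_maximal_with_odd (M : {vspace J}) : maximal_subalgebra M ->
  SF_one B \in M -> (odd_part J <= M)%VS ->
  exists M0 : {vspace V}, [/\ (M0 <= even_part V)%VS,
    (\dim M0).+1 = \dim (even_part V)
    & M = (<[SF_one B]> + SF_inj V @: M0 + odd_part J)%VS].
Proof.
move=> [[gM _] properM maxM] M1 oddM.
pose U := (SF_inj V @^-1: M :&: even_part V)%VS.
have [||H [sUH sH dH]] := @hyperplane_above _ _ U (even_part V).
- exact: capvSr.
- rewrite subv_cap subvv andbT; apply: contra properM => evM.
  rewrite eqEsubv subvf -(homog_full J) subv_add oddM andbT subv_add -memvE M1.
  apply/subvP => _ /memv_imgP[v ev ->].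
  by rewrite memv_preim (subvP evM).
exists H; split=> //; apply/esym/maxM.
- split; first by apply: graded_sum (unit_sum_even sH) (subvv _).
  suff /SF_unital_mul_closed : SF_one B \in
    (<[SF_one B]> + SF_inj V @: H + odd_part J)%VS by [].
  by rewrite -addvA memvE addvSl.
- apply: hyperplane_proper; rewrite dim_graded_sum ?unit_sum_even //.
  by rewrite dim_unit_sum dH -addSn -dim_unit_sum dim_parts.
- rewrite {1}gM; apply: addvS (capvSr _ _); apply/subvP => -[a v].
  rewrite memv_cap => /andP[Mav /SF_evenP/= ev].
  have defav : (a, v) = a *: SF_one B + SF_inj V v :> J.
    by rewrite SF_injE; congr (_, _); rewrite /= ?scaler0 ?add0r ?addr0 //
      /GRing.scale /= mulr1.
  rewrite defav memv_add ?memvZ ?memv_line //; apply: memv_img.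
  apply: (subvP sUH); rewrite memv_cap ev andbT -memv_preim.
  by rewrite -(addKr (a *: SF_one B) (SF_inj V v)) -defav memvD // memvN memvZ.
Qed.

Theorem SF_maximal_subalgebra (M : {vspace J}) :
  nondegenerate_superform B -> odd_part V != 0%VS -> subalgebra M ->
  (maximal_subalgebra M <->
   (exists M1 : {vspace J}, [/\ (M1 <= odd_part J)%VS,
      (\dim M1).+1 = \dim (odd_part J) & M = (even_part J + M1)%VS])
   \/ (exists M0 : {vspace V}, [/\ (M0 <= even_part V)%VS,
      (\dim M0).+1 = \dim (even_part V)
      & M = (<[SF_one B]> + SF_inj V @: M0 + odd_part J)%VS])).
Proof.
move=> ndB V1 subM; split=> [maxM|[[M1 [sM1 dM1 defM]]|[M0 [sM0 dM0 defM]]]].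
- have [oddM|notM] := boolP (odd_part J <= M)%VS.
    by right; apply: SF_maximal_with_odd => //; apply: SF_one_generated => //; case: subM.
  by left; apply: maximal_missing_odd (@SF_supercommutative _ _ B) (@SF_scalar_action) _ _.
- by rewrite defM in subM *; apply: even_sum_maximal.
- rewrite defM in subM *; apply: sum_odd_maximal => //.
    exact: unit_sum_even.
  by rewrite dim_unit_sum dM0 -dim_unit_sum.
Qed.

End SF.

Theorem theorem2p1 (F : closedFieldType) (charF0 : [pchar F] =i pred0) :
  [/\ (* (i) *)
      forall (J := K3 F) (M : {vspace J}), subalgebra M ->
        (maximal_subalgebra M <->
         exists M1 : {vspace J}, [/\ (M1 <= odd_part J)%VS, \dim M1 = 1%N
           & M = (even_part J + M1)%VS]),
      (* (ii) *)
      forall (t : F) (J := D t), t != 0 ->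
        forall M : {vspace J}, subalgebra M ->
        (maximal_subalgebra M <->
         (exists M1 : {vspace J}, [/\ (M1 <= odd_part J)%VS, \dim M1 = 1%N
            & M = (even_part J + M1)%VS])
         \/ (t = 1 /\ M = (<[D_one t]> + odd_part J)%VS))
    & (* (iii); [a.+1 = b] rather than [a = b.-1], as V_0 may be 0 *)
      forall (V : superspace F) (B : superform V) (J := SF B),
        nondegenerate_superform B -> odd_part V != 0%VS ->
        forall M : {vspace J}, subalgebra M ->
        (maximal_subalgebra M <->
         (exists M1 : {vspace J}, [/\ (M1 <= odd_part J)%VS,
            (\dim M1).+1 = \dim (odd_part J) & M = (even_part J + M1)%VS])
         \/ (exists M0 : {vspace V}, [/\ (M0 <= even_part V)%VS,
            (\dim M0).+1 = \dim (even_part V)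
            & M = (<[SF_one B]> + SF_inj V @: M0 + odd_part J)%VS]))].
Proof.
split=> [M|t J t0 M|V B J ndB V1 M].
- exact: K3_maximal_subalgebra.
- exact: D_maximal_subalgebra.
- exact: SF_maximal_subalgebra.
Qed.
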